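(* Let $\phi: W(2,2)\to W(2,2)$ be a linear map. Then $\phi$ is commuting if and only if there are complex numbers $\lambda,\mu$ and a linear function $\sigma: W(2,2)\to\mathbb{C}$ such that $$\phi(x)=\lambda x+\mu\,\omega(x)+\sigma(x)c\quad\text{for all } x\in W(2,2),$$ where $\omega: W(2,2)\to W(2,2)$ is the linear map defined by $\omega(L_m)=H_m$, $\omega(H_m)=\omega(c)=0$ for all $m\in\mathbb{Z}$.
   Context: All vector spaces are over $\mathbb{C}$. The W-algebra $W(2,2)$ is the complex Lie algebra with basis $\{L_m, H_m, c \mid m\in\mathbb{Z}\}$ and Lie brackets $$[L_m,L_n]=(m-n)L_{m+n}+\tfrac{m^3-m}{12}\delta_{m+n,0}\,c,\quad [L_m,H_n]=(m-n)H_{m+n}+\tfrac{m^3-m}{12}\delta_{m+n,0}\,c,\quad [H_m,H_n]=0,\quad [W(2,2),c]=0$$ for all $m,n\in\mathbb{Z}$ (the same central element $c$ appears in both the first and second brackets). A linear map $\phi:L\to L$ on a Lie algebra $L$ is called commuting if $[\phi(x),x]=0$ for all $x\in L$. *)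

(* Defs.v *)
From HB Require Import structures.
From mathcomp Require Import all_boot all_order all_algebra.
From mathcomp Require Import finmap.
From mathcomp Require Import monalg complex reals.
From mathcomp Require Import ring.

Set Implicit Arguments.
Unset Strict Implicit.
Unset Printing Implicit Defensive.

Import Order.TTheory GRing.Theory Num.Theory.
Local Open Scope ring_scope.

HB.mixin Record Lmodule_isLieAlgebra (K : fieldType) L of GRing.Lmodule K L := {
  lie : L -> L -> L;
  lie_linearl : forall y : L, linear (fun x => lie x y);
  lie_linearr : forall x : L, linear (lie x);
  liexx : forall x : L, lie x x = 0;
  lie_jacobi : forall x y z : L,
    lie x (lie y z) + lie y (lie z x) + lie z (lie x y) = 0
}.

#[short(type="lieAlgType")]
HB.structure Definition LieAlgebra (K : fieldType) :=
  { L of GRing.Lmodule K L & Lmodule_isLieAlgebra K L }.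

Notation "[ 'lie' x , y ]" := (lie x y)
  (at level 0, format "[ 'lie'  x ,  y ]") : ring_scope.

Definition commuting_map (K : fieldType) (L : lieAlgType K) (phi : L -> L) :=
  forall x : L, [lie phi x, x] = 0.

HB.lock Definition linext (K : fieldType) (I : choiceType) (V : lmodType K)
    (f : I -> V) (x : {malg K[I]}) : V :=
  \sum_(i <- msupp x) x@_i *: f i.

Arguments linext {K I V} f x.

Section LinearExtension.
Context {K : fieldType} {I : choiceType} {V : lmodType K}.
Implicit Types (f : I -> V) (x : {malg K[I]}).

Lemma linextE f x : linext f x = \sum_(i <- msupp x) x@_i *: f i.
Proof. by rewrite linext.unlock. Qed.

Lemma linextEw f x (d : {fset I}) : fsubset (msupp x) d ->
  linext f x = \sum_(i <- d) x@_i *: f i.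
Proof.
move=> sxd; rewrite linextE (big_fset_incl _ sxd) // => i _ /mcoeff_outdom ->.
by rewrite scale0r.
Qed.

Lemma linext_is_linear f : linear (linext f).
Proof.
move=> a x y; pose d := fsetU (msupp (a *: x + y)) (fsetU (msupp x) (msupp y)).
rewrite !(@linextEw f _ d) ?fsubsetUl //; last 2 first.
- by rewrite /d fsubsetU // fsubsetUr orbT.
- by rewrite /d fsubsetU // fsubsetUl orbT.
rewrite scaler_sumr -big_split /=; apply: eq_bigr => i _.
by rewrite mcoeffD mcoeffZ scalerDl scalerA.
Qed.

HB.instance Definition _ f :=
  GRing.isLinear.Build K {malg K[I]} V *:%R (linext f) (linext_is_linear f).

Lemma linextU f i : linext f << i >> = f i.
Proof.
rewrite linextE msuppU oner_eq0 big_seq_fset1.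
by rewrite mcoeffU eqxx scale1r.
Qed.

End LinearExtension.

Lemma malg_lin_ind (K : fieldType) (I : choiceType) (P : {malg K[I]} -> Prop) :
  P 0 -> (forall i, P << i >>) -> (forall a x y, P x -> P y -> P (a *: x + y)) ->
  forall x, P x.
Proof.
move=> P0 PU PD x; rewrite (monalgE x).
elim/big_rec: _ => // i y _ Py.
have -> : << x@_i *g i >> = x@_i *: << i >> :> {malg K[I]}.
  by apply/malgP=> k; rewrite mcoeffZ !mcoeffU mulrnAr mulr1.
exact: PD.
Qed.

Section Bilinear.
Context {K : fieldType} {V : lmodType K} (b : V -> V -> V).
Hypothesis b_linearl : forall y, linear (fun x => b x y).
Hypothesis b_linearr : forall x, linear (b x).

Lemma bilin0l x : b 0 x = 0.
Proof.
have := b_linearl x (-1) 0 0; rewrite scaleN1r addNr => h.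
by rewrite [LHS]h scaleN1r addNr.
Qed.

Lemma bilin0r x : b x 0 = 0.
Proof.
have := b_linearr x (-1) 0 0; rewrite scaleN1r addNr => h.
by rewrite [LHS]h scaleN1r addNr.
Qed.

Lemma bilinZr a x y : b x (a *: y) = a *: b x y.
Proof. by have := b_linearr x a y 0; rewrite !addr0 bilin0r addr0. Qed.

Lemma bilinDr x y z : b x (y + z) = b x y + b x z.
Proof. by have := b_linearr x 1 y z; rewrite !scale1r. Qed.

Definition jacobiator x y z := b x (b y z) + b y (b z x) + b z (b x y).

Lemma jacobiatorC x y z : jacobiator x y z = jacobiator y z x.
Proof. by rewrite /jacobiator -addrA addrC. Qed.

Lemma jacobiator_linearl y z : linear (fun x => jacobiator x y z).
Proof.
move=> a x1 x2; rewrite /jacobiator.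
rewrite b_linearl (b_linearr z) (b_linearr y) (b_linearl y) (b_linearr z).
by rewrite !scalerDr -!addrA; congr (_ + _); rewrite addrCA; congr (_ + _);
   rewrite [RHS]addrCA; congr (_ + _); rewrite addrCA.
Qed.

Lemma jacobiator0l y z : jacobiator 0 y z = 0.
Proof. by rewrite /jacobiator bilin0l (bilin0r z) (bilin0l y) !bilin0r !addr0. Qed.

End Bilinear.

Section BilinearExtension.
Context {K : fieldType} {I : choiceType} {V : lmodType K}.

Definition bilext (f : I -> I -> V) (x y : {malg K[I]}) : V :=
  linext (fun i => linext (f i) y) x.

Lemma bilextU f i j : bilext f << i >> << j >> = f i j.
Proof. by rewrite /bilext !linextU. Qed.

Lemma bilext_linearl f y : linear (fun x => bilext f x y).
Proof. exact: linext_is_linear. Qed.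

Lemma bilext_linearr f x : linear (bilext f x).
Proof.
have E z : bilext f x z = \sum_(i <- msupp x) x@_i *: linext (f i) z.
  exact: linextE.
move=> a y z; rewrite !E scaler_sumr -big_split /=.
apply: eq_bigr => i _; rewrite linext_is_linear.
by rewrite scalerDr !scalerA mulrC.
Qed.

End BilinearExtension.

Section FreeLie.
Context {K : fieldType} {I : choiceType} (f : I -> I -> {malg K[I]}).
Hypothesis K2 : 2%:R != 0 :> K.
Hypothesis fC : forall i j, f j i = - f i j.
Hypothesis f_jacobi : forall i j k,
  jacobiator (bilext f) << i >> << j >> << k >> = 0.
Local Notation lin := (bilext_linearl f).
Local Notation lir := (bilext_linearr f).

Lemma bilextC x y : bilext f y x = - bilext f x y.
Proof.
elim/malg_lin_ind: x y => [y|i y|a x1 x2 IH1 IH2 y].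
- by rewrite (bilin0l lin) (bilin0r lir) oppr0.
- elim/malg_lin_ind: y => [|j|a y1 y2 IH1 IH2].
  + by rewrite (bilin0l lin) (bilin0r lir) oppr0.
  + by rewrite !bilextU fC.
  + by rewrite lin lir IH1 IH2 opprD scalerN.
- by rewrite lin lir IH1 IH2 opprD scalerN.
Qed.

Lemma bilextxx x : bilext f x x = 0.
Proof.
have /eqP := bilextC x x; rewrite -addr_eq0 -mulr2n -scaler_nat scaler_eq0.
by rewrite (negPf K2) => /eqP.
Qed.

Let jac_ind y z : (forall i, jacobiator (bilext f) << i >> y z = 0) ->
  forall x, jacobiator (bilext f) x y z = 0.
Proof.
move=> h x; elim/malg_lin_ind: x => [|//|a x1 x2 h1 h2].
  exact: (jacobiator0l lin lir).
by rewrite (jacobiator_linearl lin lir) h1 h2 scaler0 addr0.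
Qed.

Lemma bilext_jacobi x y z : jacobiator (bilext f) x y z = 0.
Proof.
apply: jac_ind => i; rewrite jacobiatorC; move: y; apply: jac_ind => j.
by rewrite jacobiatorC; move: z; apply: jac_ind => k; rewrite jacobiatorC.
Qed.

End FreeLie.

(* Indices of the basis vectors L_m, H_m (m in Z) and c of W(2,2). *)
Variant w22_index := iL of int | iH of int | iC.

Definition w22_encode (i : w22_index) : int + int + unit :=
  match i with iL m => inl (inl m) | iH m => inl (inr m) | iC => inr tt end.

Definition w22_decode (s : int + int + unit) : w22_index :=
  match s with inl (inl m) => iL m | inl (inr m) => iH m | inr _ => iC end.

Lemma w22_encodeK : cancel w22_encode w22_decode.
Proof. by case. Qed.

HB.instance Definition _ := Countable.copy w22_index (can_type w22_encodeK).

Section Cocycle.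
Context {K : numFieldType}.

Definition w22_cocycle (m n : int) : K :=
  if m + n == 0 then (m ^+ 3 - m)%:~R / 12%:R else 0.

Lemma w22_cocycleC m n : w22_cocycle n m = - w22_cocycle m n.
Proof.
rewrite /w22_cocycle addrC; case: eqP => [mn0|]; last by rewrite oppr0.
have -> : n = - m by apply/eqP; rewrite -addr_eq0 addrC mn0.
by rewrite -mulNr -mulrNz; congr (_%:~R / _); ring.
Qed.

Lemma w22_cocycle_jacobi (m n p : int) :
  (n - p)%:~R * w22_cocycle m (n + p) + (p - m)%:~R * w22_cocycle n (p + m)
  + (m - n)%:~R * w22_cocycle p (m + n) = 0.
Proof.
rewrite /w22_cocycle.
have -> : n + (p + m) = m + (n + p) by ring.
have -> : p + (m + n) = m + (n + p) by ring.
case: eqP => [mnp0|]; last by rewrite !mulr0 !addr0.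
have -> : p = - m - n.
  by apply/eqP; rewrite -subr_eq0 -mnp0; apply/eqP; ring.
by rewrite !mulrA -!mulrDl -!rmorphM -!rmorphD /=
           [X in X%:~R](_ : _ = 0) ?mul0r //; ring.
Qed.

Lemma w22_jacobi_sum (V : lmodType K) (X : int -> V) (c : V) (m n p : int) :
  (n - p)%:~R *: ((m - (n + p))%:~R *: X (m + (n + p))
                   + w22_cocycle m (n + p) *: c)
  + (p - m)%:~R *: ((n - (p + m))%:~R *: X (n + (p + m))
                   + w22_cocycle n (p + m) *: c)
  + (m - n)%:~R *: ((p - (m + n))%:~R *: X (p + (m + n))
                   + w22_cocycle p (m + n) *: c) = 0.
Proof.
have -> : X (n + (p + m)) = X (m + (n + p)) by congr X; ring.
have -> : X (p + (m + n)) = X (m + (n + p)) by congr X; ring.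
rewrite !scalerDr !scalerA (addrACA (_ *: X _)) -!scalerDl.
rewrite addrACA -!scalerDl.
rewrite w22_cocycle_jacobi scale0r addr0 -!rmorphM -!rmorphD /=.
by rewrite [X in X%:~R](_ : _ = 0) ?scale0r //; ring.
Qed.

End Cocycle.

(* The free K-module on w22_index: finitely supported families of
   coefficients, so that the vectors << i >> form a basis. *)
Definition W22 (K : numFieldType) : Type := {malg K[w22_index]}.

HB.instance Definition _ (K : numFieldType) := GRing.Lmodule.on (W22 K).

Section W22.
Context {K : numFieldType}.
Local Notation W := (W22 K).

Definition w22L (m : int) : W := << iL m >>.
Definition w22H (m : int) : W := << iH m >>.
Definition w22c : W := << iC >>.

(* The bracket [H_m, L_n] is forced by antisymmetry: it is -[L_n, H_m]. *)
Definition w22_basis_lie (i j : w22_index) : W :=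
  match i, j with
  | iL m, iL n => (m - n)%:~R *: w22L (m + n) + w22_cocycle m n *: w22c
  | iL m, iH n => (m - n)%:~R *: w22H (m + n) + w22_cocycle m n *: w22c
  | iH m, iL n => - ((n - m)%:~R *: w22H (n + m) + w22_cocycle n m *: w22c)
  | iH _, iH _ => 0
  | iC, _ | _, iC => 0
  end.

Lemma w22_basis_lieC i j : w22_basis_lie j i = - w22_basis_lie i j.
Proof.
case: i j => [m|m|] [n|n|] /=; rewrite ?oppr0 ?opprK //.
all: by rewrite w22_cocycleC scaleNr opprD -(opprB m n) mulrNz scaleNr (addrC n).
Qed.

Lemma w22_basis_lieHL m n : w22_basis_lie (iH m) (iL n) =
  (m - n)%:~R *: w22H (m + n) + w22_cocycle m n *: w22c.
Proof.
rewrite /= (w22_cocycleC m) scaleNr opprD opprK.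
by rewrite -(opprB m n) mulrNz scaleNr opprK (addrC n).
Qed.

Let w22_basis_liec i : w22_basis_lie i iC = 0.
Proof. by case: i. Qed.

Lemma w22_basis_jacobi i j k :
  jacobiator (bilext w22_basis_lie) << i >> << j >> << k >> = 0.
Proof.
rewrite /jacobiator !bilextU.
have lir := bilext_linearr w22_basis_lie.
have lie0 l : bilext w22_basis_lie << l >> 0 = 0 by exact: (bilin0r lir).
have lieE a d l t : bilext w22_basis_lie << l >> (a *: << t >> + d *: << iC >>)
    = a *: w22_basis_lie l t.
  rewrite (bilinDr lir) !(bilinZr lir) !bilextU w22_basis_liec.
  by rewrite scaler0 addr0.
case: i j k => [m|m|] [n|n|] [p|p|];
  rewrite ?w22_basis_lieHL /= /w22L /w22H /w22c ?lieE ?lie0;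
  rewrite ?w22_basis_lieHL /= ?(scaler0, addr0) //.
- exact: (w22_jacobi_sum w22L).
all: exact: (w22_jacobi_sum w22H).
Qed.

Let char2 : 2%:R != 0 :> K.
Proof. by rewrite pnatr_eq0. Qed.

HB.instance Definition _ := Lmodule_isLieAlgebra.Build K (W22 K)
  (bilext_linearl w22_basis_lie) (bilext_linearr w22_basis_lie)
  (bilextxx char2 w22_basis_lieC)
  (bilext_jacobi w22_basis_jacobi).

Lemma w22_lieLL m n : [lie w22L m, w22L n] =
  (m - n)%:~R *: w22L (m + n)
  + (if m + n == 0 then (m ^+ 3 - m)%:~R / 12%:R else 0) *: w22c.
Proof. exact: bilextU. Qed.

Lemma w22_lieLH m n : [lie w22L m, w22H n] =
  (m - n)%:~R *: w22H (m + n)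
  + (if m + n == 0 then (m ^+ 3 - m)%:~R / 12%:R else 0) *: w22c.
Proof. exact: bilextU. Qed.

Lemma w22_lieHH m n : [lie w22H m, w22H n] = 0.
Proof. exact: bilextU. Qed.

Lemma w22_liexc (x : W) : [lie x, w22c] = 0.
Proof.
elim/malg_lin_ind: x => [|i|a x y hx hy].
- exact: (bilin0l (bilext_linearl w22_basis_lie)).
- by rewrite [LHS]bilextU; case: i.
- by rewrite lie_linearl hx hy scaler0 addr0.
Qed.

Definition w22_omega : W -> W :=
  linext (fun i => if i is iL m then w22H m else 0).

HB.instance Definition _ := GRing.Linear.on w22_omega.

Lemma w22_omegaL m : w22_omega (w22L m) = w22H m.
Proof. exact: linextU. Qed.

Lemma w22_omegaH m : w22_omega (w22H m) = 0.
Proof. exact: linextU. Qed.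

Lemma w22_omegac : w22_omega w22c = 0.
Proof. exact: linextU. Qed.

End W22.

(* Main.v *)
Require Import Defs.
From mathcomp Require Import all_boot all_order all_algebra.
From mathcomp Require Import complex reals.
From HB Require Import structures.
From mathcomp Require Import monalg.

Import GRing.Theory Num.Theory.
Local Open Scope ring_scope.

(** The bracket of a commuting linear map can be moved from one side to the
    other: polarizing [phi x, x] = 0 gives [phi x, y] = [x, phi y]. Hence,
    once phi sends some y to a central element, every value phi x centralizes
    y.

    In W(2,2) the operator ad L_0 is diagonal in the given basis, and the
    eigenvalue 0 occurs exactly on L_0, H_0 and c. As phi L_0 commutes with
    L_0, it is lambda L_0 + mu H_0 modulo c, which is what the commuting map
    lambda id + mu omega does to L_0. The difference psi of phi and this map is
    commuting and sends L_0 into the centre, so every psi x centralizes L_0.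
    In particular psi L_1 centralizes both L_0 and L_1. Only multiples of c do
    ([w22_centralizer_L0L1]), so psi L_1 is central too, and therefore every
    psi x centralizes L_0 and L_1 and is a multiple of c.

    Conversely id and omega are commuting, as is any map into the centre, and
    commuting maps form a vector space. *)

(** * Commuting maps of a Lie algebra *)

Section CommutingMaps.
Context {K : fieldType} {L : lieAlgType K}.
Implicit Types (x y z : L).

Lemma lie0l y : [lie 0, y] = 0.
Proof. exact: (bilin0l (@lie_linearl K L)). Qed.

Lemma lieDl x y z : [lie x + y, z] = [lie x, z] + [lie y, z].
Proof. by have := lie_linearl z 1 x y; rewrite !scale1r. Qed.

Lemma lieZl a x y : [lie a *: x, y] = a *: [lie x, y].
Proof. by have := lie_linearl y a x 0; rewrite !addr0 lie0l addr0. Qed.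

Lemma lie0r x : [lie x, 0] = 0.
Proof. exact: (bilin0r (@lie_linearr K L)). Qed.

Lemma lieDr x y z : [lie x, y + z] = [lie x, y] + [lie x, z].
Proof. exact: (bilinDr (@lie_linearr K L)). Qed.

Lemma lieZr a x y : [lie x, a *: y] = a *: [lie x, y].
Proof. exact: (bilinZr (@lie_linearr K L)). Qed.

Lemma lieC x y : [lie y, x] = - [lie x, y].
Proof.
have := liexx (x + y); rewrite lieDl !lieDr !liexx add0r addr0.
by move/eqP; rewrite addrC addr_eq0 => /eqP.
Qed.

Lemma commuting_map_id : commuting_map (fun x : L => x).
Proof. exact: liexx. Qed.

Lemma commuting_map_comb a (phi psi : L -> L) :
  commuting_map phi -> commuting_map psi ->
  commuting_map (fun x => a *: phi x + psi x).
Proof. by move=> hphi hpsi x; rewrite lieDl lieZl hphi hpsi scaler0 addr0. Qed.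

Lemma commuting_map_central z (s : L -> K) :
  (forall x, [lie x, z] = 0) -> commuting_map (fun x => s x *: z).
Proof. by move=> zC x; rewrite lieZl lieC zC oppr0 scaler0. Qed.

Lemma commuting_map_polar (phi : {linear L -> L}) :
  commuting_map phi -> forall x y, [lie phi x, y] = [lie x, phi y].
Proof.
move=> h x y; have := h (x + y).
rewrite linearD lieDl !lieDr !h add0r addr0 (lieC x (phi y)).
by move/eqP; rewrite subr_eq0 => /eqP.
Qed.

Lemma commuting_map_of_polar (phi : L -> L) : 2%:R != 0 :> K ->
  (forall x y, [lie phi x, y] = [lie x, phi y]) -> commuting_map phi.
Proof.
move=> K2 h x; have /eqP := h x x; rewrite (lieC (phi x)) -addr_eq0 -mulr2n.
by rewrite -scaler_nat scaler_eq0 (negPf K2) => /eqP.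
Qed.

(** One central value restricts all values at once; this is what propagates
    information from L_0 to L_1 and then to the whole algebra. *)
Lemma commuting_map_centralizes (phi : {linear L -> L}) y :
  commuting_map phi -> (forall x, [lie x, phi y] = 0) ->
  forall x, [lie phi x, y] = 0.
Proof. by move=> h hy x; rewrite commuting_map_polar. Qed.

End CommutingMaps.

(** * Linear combinations of three vectors *)

(** These are stated for variables because rewriting by linearity under basis
    vectors makes conversion compare, say, [w22L 0] with [w22H 0] by unfolding
    the finitely supported functions behind them, which is very slow. *)
Lemma scalar_comb3 {K : pzRingType} {V : lmodType K} (f : {scalar V})
    (a b d : K) (x y z : V) :
  f (a *: x + b *: y + d *: z) = a * f x + b * f y + d * f z.
Proof. by rewrite 2!linearD 3!linearZ. Qed.

Lemma lie_comb3 {K : fieldType} {L : lieAlgType K} (a b d : K) (x y z t : L) :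
  [lie a *: x + b *: y + d *: z, t]
    = a *: [lie x, t] + b *: [lie y, t] + d *: [lie z, t].
Proof. by rewrite 2!lieDl 3!lieZl. Qed.

Lemma subr_comb3 {K : pzRingType} {V : lmodType K} (a b : K) (x y z : V) :
  - a *: x + (- b *: y + (a *: x + b *: y + z)) = z.
Proof. by rewrite !scaleNr -!addrA addrCA !addKr. Qed.

(** * Centralizers and commuting maps in W(2,2) *)

Section W22.
Context {K : numFieldType}.
Local Notation W := (W22 K).
Local Notation L_ := (@w22L K).
Local Notation H_ := (@w22H K).
Local Notation c_ := (@w22c K).

(** [malg_lin_ind] retyped, so that the sums in the induction step are those
    of the Lie algebra and rewriting with bilinearity applies to them. *)
Lemma w22_lin_ind (P : W -> Prop) : P 0 -> (forall i, P << i >>) ->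
  (forall a (x y : W), P x -> P y -> P (a *: x + y)) -> forall x, P x.
Proof. exact: malg_lin_ind. Qed.

Lemma w22_lieHL m n : [lie H_ m, L_ n] = [lie L_ m, H_ n].
Proof. by rewrite [LHS]bilextU [RHS]bilextU w22_basis_lieHL. Qed.

Lemma w22_lieZc (a : K) (x : W) : [lie x, a *: c_] = 0.
Proof. by rewrite lieZr w22_liexc scaler0. Qed.

(** On basis vectors both sides vanish except in the case of two L's, where the
    identity is [H_m, L_n] = [L_m, H_n]. *)
Lemma w22_omega_polar (x y : W) : [lie w22_omega x, y] = [lie x, w22_omega y].
Proof.
elim/w22_lin_ind: x => [|i|a x1 x2 h1 h2]; first by rewrite linear0 !lie0l.
  elim/w22_lin_ind: y => [|j|a y1 y2 h1 h2]; first by rewrite linear0 !lie0r.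
    have lc0 k : [lie c_, << k >> : W] = 0 by rewrite lieC w22_liexc oppr0.
    case: i j => [m|m|] [n|n|]; rewrite -?/(L_ _) -?/(H_ _) -?/c_;
      rewrite ?(w22_omegaL, w22_omegaH, w22_omegac) ?lie0l ?lie0r //.
    - exact: w22_lieHL.
    - exact: w22_lieHH.
    - by rewrite w22_liexc.
    - by rewrite w22_lieHH.
    - by rewrite lc0.
  by rewrite linearP !lieDr !lieZr h1 h2.
by rewrite linearP !lieDl !lieZl h1 h2.
Qed.

Lemma commuting_map_omega : commuting_map (@w22_omega K).
Proof. by apply: commuting_map_of_polar w22_omega_polar; rewrite pnatr_eq0. Qed.

(** The eigenvalues of the bracket with L_0 on the right; the sign is the
    opposite of that of ad L_0. *)
Definition w22_weight (i : w22_index) : int :=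
  match i with iL m | iH m => m | iC => 0 end.

(** The reason why no multiple of c appears in brackets with L_0: m^3 - m
    vanishes at m = 0. *)
Lemma w22_cocycle0r (m : int) : w22_cocycle m 0 = 0 :> K.
Proof.
rewrite /w22_cocycle addr0.
by case: eqP => // ->; rewrite expr0n subr0 mul0r.
Qed.

(** The coefficient functional retyped on [W22 K], so that it is linear for
    the module structure of the Lie algebra. *)
Definition w22_coef (i : w22_index) (x : W) : K := x@_i.

Lemma w22_coef_is_scalar i : scalar (w22_coef i).
Proof. by move=> a x y; rewrite /w22_coef mcoeffD mcoeffZ. Qed.

HB.instance Definition _ i :=
  GRing.isLinear.Build K W K *%R (w22_coef i) (w22_coef_is_scalar i).

Lemma w22_coefU i j : w22_coef i << j >> = (j == i)%:R.
Proof. exact: mcoeffU. Qed.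

Lemma w22_coefP (x y : W) : (forall i, w22_coef i x = w22_coef i y) -> x = y.
Proof. by move=> h; apply/malgP. Qed.

Lemma w22_lieL0 i :
  [lie (<< i >> : W), L_ 0] = (w22_weight i)%:~R *: (<< i >> : W).
Proof.
rewrite [LHS]bilextU.
case: i => [m|m|]; rewrite ?w22_basis_lieHL /= ?scale0r //;
  (* For integers - 0 reduces to 0, so [subr0] also simplifies m + 0. *)
  by rewrite subr0 w22_cocycle0r scale0r addr0.
Qed.

Lemma w22_coef_lieL0 (x : W) i :
  w22_coef i [lie x, L_ 0] = (w22_weight i)%:~R * w22_coef i x.
Proof.
elim/w22_lin_ind: x => [|j|a x y hx hy].
- by rewrite lie0l !linear0 mulr0.
- rewrite w22_lieL0 linearZ /= w22_coefU; case: (eqVneq j i) => [->//|_].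
  by rewrite !mulr0.
- by rewrite lieDl lieZl 2!linearP /= hx hy mulrDr mulrCA.
Qed.

(** A coefficient of nonzero weight is killed by its eigenvalue, and the
    indices of weight 0 are exactly [iL 0], [iH 0] and [iC]. *)
Lemma w22_centralizer_L0 (x : W) : [lie x, L_ 0] = 0 ->
  x = w22_coef (iL 0) x *: L_ 0 + w22_coef (iH 0) x *: H_ 0
      + w22_coef iC x *: c_.
Proof.
move=> hx; apply: w22_coefP => i.
rewrite scalar_comb3 /= 3!w22_coefU.
have := w22_coef_lieL0 x i; rewrite hx linear0.
have [w0 _|w0] := eqVneq (w22_weight i) 0.
  by case: i w0 => [m|m|] /= => [->|->|_];
    rewrite ?eqxx /= ?(mulr1, mulr0, addr0, add0r).
move/esym/eqP; rewrite mulf_eq0 intr_eq0 (negPf w0) /= => /eqP ->.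
have ne j : w22_weight j = 0 -> (j == i) = false.
  by move=> j0; apply: contraNF w0 => /eqP <-; rewrite j0.
by rewrite !ne // !mulr0 !addr0.
Qed.

(** Within the span of L_0, H_0 and c, bracketing with L_1 sends L_0 to - L_1
    and H_0 to - H_1, which are independent. *)
Lemma w22_centralizer_L0L1 (x : W) :
  [lie x, L_ 0] = 0 -> [lie x, L_ 1] = 0 -> x = w22_coef iC x *: c_.
Proof.
move=> /w22_centralizer_L0.
move: (w22_coef (iL 0) x) (w22_coef (iH 0) x) (w22_coef iC x) => a b d -> h1.
have L01 : [lie L_ 0, L_ 1] = - L_ 1.
  by rewrite lieC; congr (- _); rewrite -[RHS]scale1r; exact: w22_lieL0.
have H01 : [lie H_ 0, L_ 1] = - H_ 1.
  by rewrite w22_lieHL lieC; congr (- _); rewrite -[RHS]scale1r;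
     exact: w22_lieL0.
have coef i : a * w22_coef i (L_ 1) + b * w22_coef i (H_ 1) = 0.
  have := congr1 (w22_coef i) h1.
  rewrite lie_comb3 scalar_comb3 /= L01 H01 (lieC (L_ 1)) w22_liexc oppr0.
  rewrite linear0 mulr0 addr0 2!linearN 2!mulrN -opprD => /eqP.
  by rewrite oppr_eq0 => /eqP.
have -> : a = 0.
  by have := coef (iL 1); rewrite 2!w22_coefU eqxx mulr1 mulr0 addr0.
have -> : b = 0.
  by have := coef (iH 1); rewrite 2!w22_coefU eqxx mulr1 mulr0 add0r.
by rewrite 2!scale0r 2!add0r.
Qed.

(** The values centralize L_0; the value at L_1 moreover commutes with L_1
    because the map is commuting, so it is central as well, and then all values
    centralize L_0 and L_1. *)
Lemma w22_commuting_central (psi : {linear W -> W}) (s : K) :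
  commuting_map psi -> psi (L_ 0) = s *: c_ ->
  forall x, psi x = w22_coef iC (psi x) *: c_.
Proof.
move=> hpsi psi0.
have C0 : forall x, [lie psi x, L_ 0] = 0.
  by apply: commuting_map_centralizes => // x; rewrite psi0 w22_lieZc.
have psi1 := w22_centralizer_L0L1 _ (C0 _) (hpsi (L_ 1)).
have C1 : forall x, [lie psi x, L_ 1] = 0.
  by apply: commuting_map_centralizes => // x; rewrite psi1 w22_lieZc.
by move=> x; apply: w22_centralizer_L0L1.
Qed.

Lemma w22_commuting_mapP (phi : {linear W -> W}) :
  commuting_map phi <->
  exists (lambda mu : K) (sigma : {scalar W}),
    forall x : W, phi x = lambda *: x + mu *: w22_omega x + sigma x *: w22c.
Proof.
split=> [hphi | [lambda [mu [sigma phiE]]] x]; last first.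
  rewrite phiE -addrA.
  apply: (commuting_map_comb lambda (fun y : W => y)
    (fun y => mu *: w22_omega y + sigma y *: w22c)).
    exact: commuting_map_id.
  apply: (commuting_map_comb mu (@w22_omega K) (fun y => sigma y *: w22c)).
    exact: commuting_map_omega.
  exact/commuting_map_central/w22_liexc.
set y0 : W := phi (L_ 0).
(* lambda and mu are read off from phi L_0 = lambda L_0 + mu H_0 modulo c. *)
pose lambda := w22_coef (iL 0) y0; pose mu := w22_coef (iH 0) y0.
pose psi : {linear W -> W} :=
  (- lambda \*: idfun \+ (- mu \*: @w22_omega K \+ phi)).
have psiE x : psi x = - lambda *: x + (- mu *: w22_omega x + phi x) by [].
have hpsi : commuting_map psi.
  apply: (commuting_map_comb (- lambda) (fun y : W => y)
    (fun y => - mu *: w22_omega y + phi y)); first exact: commuting_map_id.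
  apply: (commuting_map_comb (- mu) (@w22_omega K) phi) => //.
  exact: commuting_map_omega.
have psi0 : psi (L_ 0) = w22_coef iC y0 *: c_.
  rewrite psiE w22_omegaL -/y0 [X in _ + (_ + X)]
    (w22_centralizer_L0 _ (hphi _)).
  exact: subr_comb3.
have psic := w22_commuting_central _ _ hpsi psi0.
exists lambda, mu, (w22_coef iC \o psi) => x.
by rewrite /= -psic psiE !scaleNr addrACA subrr add0r addNKr.
Qed.

End W22.

Theorem theorem4p1 (R : realType) (phi : {linear W22 R[i] -> W22 R[i]}) :
  commuting_map phi <->
  exists (lambda mu : R[i]) (sigma : {scalar W22 R[i]}),
    forall x : W22 R[i],
      phi x = lambda *: x + mu *: w22_omega x + sigma x *: w22c.
Proof. exact: w22_commuting_mapP. Qed.
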